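(* Let $ABC$ be a (nondegenerate) triangle in the Euclidean plane and let $0 < k \le 1$. Let $A_1$ be the point of the side $BC$ with $\angle BAA_1 = k\,\angle BAC$, and let $B_1$ be the point of the side $AC$ with $\angle ABB_1 = k\,\angle ABC$ (so that $AA_1$ and $BB_1$ are the $k$-trisas of the triangle from $A$ and $B$). If $|AA_1| = |BB_1|$, then $ABC$ is isosceles with $AC = BC$.
   Context: All angles are oriented: for the angle $BAC$, the ray $AA_1$ is called a $k$-trisa ($-\infty<k<\infty$) if $\angle BAA_1 = k\,\angle BAC$; analogously, for the angle at $B$ the $k$-trisa $BB_1$ is given by $\angle ABB_1 = k\,\angle ABC$ (both measured starting from the side $AB$). For $k=1$ the $k$-trisas coincide with the sides $AC$ and $BC$, i.e. $A_1 = B_1 = C$. *)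

(* Defs.v *)
(* The Euclidean plane is R * R with its standard metric and orientation. *)
From Stdlib Require Export Reals.
Open Scope R_scope.

Definition point : Type := (R * R)%type.

Definition len (P Q : point) : R :=
  dist_euc (fst P) (snd P) (fst Q) (snd Q).

Definition collinear (P Q S : point) : Prop :=
  exists a b c : R, (a <> 0 \/ b <> 0) /\
    a * fst P + b * snd P = c /\
    a * fst Q + b * snd Q = c /\
    a * fst S + b * snd S = c.

Definition nondegenerate_triangle (A B C : point) : Prop := ~ collinear A B C.

Definition on_segment (P Q X : point) : Prop :=
  exists t : R, 0 <= t <= 1 /\
    fst X = (1 - t) * fst P + t * fst Q /\
    snd X = (1 - t) * snd P + t * snd Q.

(* Dot and cross product of the vectors VP and VQ. *)
Definition dot (V P Q : point) : R :=
  (fst P - fst V) * (fst Q - fst V) + (snd P - snd V) * (snd Q - snd V).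

Definition cross (V P Q : point) : R :=
  (fst P - fst V) * (snd Q - snd V) - (snd P - snd V) * (fst Q - fst V).

(* Oriented angle PVQ: the representative in (-PI, PI] of the rotation angle,
   counterclockwise positive, taking the ray VP to the ray VQ.  It is only
   meaningful when P <> V and Q <> V. *)
Definition angle (P V Q : point) : R :=
  let theta := acos (dot V P Q / (len V P * len V Q)) in
  if Rlt_dec (cross V P Q) 0 then - theta else theta.

(* Main.v *)
Require Import Defs.
From Stdlib Require Import Reals.
From Stdlib Require Import Lra.

(** Write [x], [y] for the unsigned angles at [A] and [B].  The law of sines in
    the triangle [A B A1], whose angles at [A] and [B] are [k x] and [y], gives
    [|AA1| sin (k x + y) = |AB| sin y] ([cevian_sine_law]); exchanging [A] and
    [B], [|BB1| sin (k y + x) = |AB| sin x].  Equality of the two cevians thus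
    becomes [sin y sin (k y + x) = sin x sin (k x + y)], and it remains to see
    that this forces [x = y] ([equal_trisa_angles]).

    Suppose [y < x], and put [s = (x + y) / 2], [d = (x - y) / 2], so that
    [0 < d < s < PI / 2].  By the product-to-sum formulas,
    [sin x sin (k x + y) - sin y sin (k y + x)
     = sin (k s) sin ((2 - k) d) + sin ((2 + k) s) sin (k d)].
    Since [sin ((2 - k) z) / sin (k z)] does not increase with [z]
    ([sin_multiples_cross_le]), the right side is at least
    [sin (k d) (sin ((2 - k) s) + sin ((2 + k) s))
     = 2 sin (k d) sin (2 s) cos (k s)], which is positive.  The monotonicity
    is itself turned by product-to-sum formulas into that of
    [sin (e z) / sin z] on [(0, PI)] for [0 <= e <= 1]
    ([sin_ratio_nondecreasing]), which follows by differentiating twice. *)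

(** * Monotonicity of quotients of sines *)

Lemma derivable_pt_lim_sin_scal (e c : R) :
  derivable_pt_lim (fun t => sin (e * t)) c (cos (e * c) * e).
Proof.
apply (derivable_pt_lim_comp (fun t => e * t) sin).
- pose proof (derivable_pt_lim_scal id e c 1 (derivable_pt_lim_id c)) as H.
  rewrite Rmult_1_r in H; exact H.
- apply derivable_pt_lim_sin.
Qed.

Lemma derivable_pt_lim_cos_scal (e c : R) :
  derivable_pt_lim (fun t => cos (e * t)) c (- sin (e * c) * e).
Proof.
apply (derivable_pt_lim_comp (fun t => e * t) cos).
- pose proof (derivable_pt_lim_scal id e c 1 (derivable_pt_lim_id c)) as H.
  rewrite Rmult_1_r in H; exact H.
- apply derivable_pt_lim_cos.
Qed.

(** Numerator of the derivative of [sin (e z) / sin z]; its own derivative is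
    [(1 - e^2) sin (e z) sin z]. *)
Lemma sin_ratio_derivative_nonneg (e z : R) :
  0 <= e <= 1 -> 0 < z < PI ->
  0 <= e * cos (e * z) * sin z - sin (e * z) * cos z.
Proof.
intros He Hz.
destruct (MVT_cor2 (fun t => e * cos (e * t) * sin t - sin (e * t) * cos t)
  (fun t => (1 - e * e) * (sin (e * t) * sin t)) 0 z) as [c [Hc Hcz]].
- lra.
- intros c _.
  pose proof (derivable_pt_lim_cos_scal e c) as Hcos.
  pose proof (derivable_pt_lim_sin_scal e c) as Hsin.
  replace ((1 - e * e) * (sin (e * c) * sin c)) with
    ((e * (- sin (e * c) * e)) * sin c + (e * cos (e * c)) * cos c
     - ((cos (e * c) * e) * cos c + sin (e * c) * (- sin c))) by ring.
  apply (derivable_pt_lim_minus (fun t => e * cos (e * t) * sin t)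
           (fun t => sin (e * t) * cos t)).
  + apply (derivable_pt_lim_mult (fun t => e * cos (e * t)) sin).
    * exact (derivable_pt_lim_scal _ e c _ Hcos).
    * apply derivable_pt_lim_sin.
  + apply (derivable_pt_lim_mult (fun t => sin (e * t)) cos _ _ _ Hsin).
    apply derivable_pt_lim_cos.
- assert (Hs0 : 0 <= sin (e * c)) by (apply sin_ge_0; nra).
  assert (Hs1 : 0 <= sin c) by (apply sin_ge_0; lra).
  assert (Hprod : 0 <= sin (e * c) * sin c) by (apply Rmult_le_pos; lra).
  assert (Hprod' : 0 <= (1 - e * e) * (sin (e * c) * sin c))
    by (apply Rmult_le_pos; nra).
  rewrite Rmult_0_r, sin_0 in Hc.
  nra.
Qed.

(** [sin (e q) / sin q <= sin (e p) / sin p], without denominators. *)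
Lemma sin_ratio_nondecreasing (e p q : R) :
  0 <= e <= 1 -> 0 < q < p -> p < PI ->
  sin p * sin (e * q) <= sin (e * p) * sin q.
Proof.
intros He Hq Hp.
destruct (MVT_cor2 (fun t => sin (e * t) / sin t)
  (fun t => (e * cos (e * t) * sin t - sin (e * t) * cos t) / Rsqr (sin t)) q p)
  as [c [Hc Hcz]].
- lra.
- intros c Hcz.
  pose proof (derivable_pt_lim_sin_scal e c) as Hsin.
  assert (Hpos : 0 < sin c) by (apply sin_gt_0; lra).
  replace (e * cos (e * c) * sin c - sin (e * c) * cos c) with
    (cos (e * c) * e * sin c - cos c * sin (e * c)) by ring.
  apply (derivable_pt_lim_div (fun t => sin (e * t)) sin _ _ _ Hsin).
  + apply derivable_pt_lim_sin.
  + lra.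
- assert (Hsc : 0 < sin c) by (apply sin_gt_0; lra).
  assert (Hsp : 0 < sin p) by (apply sin_gt_0; lra).
  assert (Hsq : 0 < sin q) by (apply sin_gt_0; lra).
  assert (Hnum : 0 <= e * cos (e * c) * sin c - sin (e * c) * cos c)
    by (apply sin_ratio_derivative_nonneg; lra).
  assert (Hder : 0 <= (e * cos (e * c) * sin c - sin (e * c) * cos c)
                      / Rsqr (sin c)).
  { apply Rmult_le_pos; [exact Hnum|].
    left; apply Rinv_0_lt_compat, Rsqr_pos_lt; lra. }
  assert (Hle : 0 <= sin (e * p) / sin p - sin (e * q) / sin q)
    by (rewrite Hc; apply Rmult_le_pos; lra).
  apply Rminus_le.
  replace (sin p * sin (e * q) - sin (e * p) * sin q) with
    (- ((sin (e * p) / sin p - sin (e * q) / sin q) * (sin p * sin q)))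
    by (field; lra).
  assert (0 < sin p * sin q) by nra.
  nra.
Qed.

Lemma sin_mult_sin (a b : R) : 2 * (sin a * sin b) = cos (a - b) - cos (a + b).
Proof. rewrite cos_minus, cos_plus; ring. Qed.

(** [sin ((2 - k) s) / sin (k s) <= sin ((2 - k) d) / sin (k d)], without
    denominators. *)
Lemma sin_multiples_cross_le (k d s : R) :
  0 < k <= 1 -> 0 < d < s -> s < PI / 2 ->
  sin ((2 - k) * s) * sin (k * d) <= sin (k * s) * sin ((2 - k) * d).
Proof.
intros Hk Hd Hs.
(* With [e = 1 - k] the multipliers [2 - k] and [k] are [1 + e] and [1 - e]. *)
pose proof (sin_ratio_nondecreasing (1 - k) (s + d) (s - d)
  ltac:(lra) ltac:(lra) ltac:(lra)) as H.
pose proof (sin_mult_sin ((2 - k) * s) (k * d)) as E1.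
pose proof (sin_mult_sin (k * s) ((2 - k) * d)) as E2.
pose proof (sin_mult_sin (s + d) ((1 - k) * (s - d))) as E3.
pose proof (sin_mult_sin ((1 - k) * (s + d)) (s - d)) as E4.
replace ((2 - k) * s - k * d) with ((1 - k) * (s + d) + (s - d)) in E1 by ring.
replace ((2 - k) * s + k * d) with (s + d + (1 - k) * (s - d)) in E1 by ring.
replace (k * s - (2 - k) * d) with (- ((1 - k) * (s + d) - (s - d))) in E2
  by ring.
rewrite cos_neg in E2.
replace (k * s + (2 - k) * d) with (s + d - (1 - k) * (s - d)) in E2 by ring.
lra.
Qed.

(** * Comparison of the two angles *)

(** The larger angle has the shorter trisa. *)
Lemma larger_angle_shorter_trisa (k x y : R) :
  0 < k <= 1 -> 0 < y < x -> x + y < PI ->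
  sin y * sin (k * y + x) < sin x * sin (k * x + y).
Proof.
intros Hk Hy Hxy.
assert (Hs : exists s d, x = s + d /\ y = s - d)
  by (exists ((x + y) / 2), ((x - y) / 2); lra).
destruct Hs as [s [d [-> ->]]].
pose proof (sin_multiples_cross_le k d s Hk ltac:(lra) ltac:(lra)) as Hmono.
assert (Hdiff : sin (s + d) * sin (k * (s + d) + (s - d))
                - sin (s - d) * sin (k * (s - d) + (s + d))
                = sin (k * s) * sin ((2 - k) * d)
                  + sin ((2 + k) * s) * sin (k * d)).
{ pose proof (sin_mult_sin (s + d) (k * (s + d) + (s - d))) as E1.
  pose proof (sin_mult_sin (s - d) (k * (s - d) + (s + d))) as E2.
  pose proof (sin_mult_sin (k * s) ((2 - k) * d)) as E3.
  pose proof (sin_mult_sin ((2 + k) * s) (k * d)) as E4.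
  replace (s + d - (k * (s + d) + (s - d))) with
    (- (k * s - (2 - k) * d)) in E1 by ring.
  rewrite cos_neg in E1.
  replace (s + d + (k * (s + d) + (s - d))) with
    ((2 + k) * s + k * d) in E1 by ring.
  replace (s - d - (k * (s - d) + (s + d))) with
    (- (k * s + (2 - k) * d)) in E2 by ring.
  rewrite cos_neg in E2.
  replace (s - d + (k * (s - d) + (s + d))) with
    ((2 + k) * s - k * d) in E2 by ring.
  lra. }
assert (Hsum : sin ((2 - k) * s) + sin ((2 + k) * s)
               = 2 * (sin (2 * s) * cos (k * s))).
{ replace ((2 - k) * s) with (2 * s - k * s) by ring.
  replace ((2 + k) * s) with (2 * s + k * s) by ring.
  rewrite sin_minus, sin_plus; ring. }
assert (0 < sin (k * d)) by (apply sin_gt_0; nra).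
assert (0 < sin (2 * s)) by (apply sin_gt_0; lra).
assert (0 < cos (k * s)) by (apply cos_gt_0; nra).
assert (0 < sin (2 * s) * cos (k * s)) by (apply Rmult_lt_0_compat; lra).
assert (0 < sin (k * d) * (sin ((2 - k) * s) + sin ((2 + k) * s)))
  by (apply Rmult_lt_0_compat; lra).
nra.
Qed.

Lemma equal_trisa_angles (k x y : R) :
  0 < k <= 1 -> 0 < x -> 0 < y -> x + y < PI ->
  sin y * sin (k * y + x) = sin x * sin (k * x + y) -> x = y.
Proof.
intros Hk Hx Hy Hxy E.
destruct (Rtotal_order x y) as [H|[H|H]]; [|exact H|].
- pose proof (larger_angle_shorter_trisa k y x Hk ltac:(lra) ltac:(lra)); lra.
- pose proof (larger_angle_shorter_trisa k x y Hk ltac:(lra) ltac:(lra)); lra.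
Qed.

(** * Lengths, oriented angles and cross products *)

Lemma len_nonneg (P Q : point) : 0 <= len P Q.
Proof. apply sqrt_pos. Qed.

Lemma len_sym (P Q : point) : len P Q = len Q P.
Proof. apply distance_symm. Qed.

Lemma len_sqr (P Q : point) :
  len P Q * len P Q = (fst Q - fst P) ^ 2 + (snd Q - snd P) ^ 2.
Proof.
unfold len, dist_euc; rewrite sqrt_sqrt.
- unfold Rsqr; ring.
- apply Rplus_le_le_0_compat; apply Rle_0_sqr.
Qed.

Lemma len_eq_0 (P Q : point) :
  len P Q = 0 -> fst P = fst Q /\ snd P = snd Q.
Proof.
intros H; pose proof (len_sqr P Q) as E; rewrite H in E.
pose proof (pow2_ge_0 (fst Q - fst P)).
pose proof (pow2_ge_0 (snd Q - snd P)).
split; apply Rminus_diag_uniq_sym, Rsqr_0_uniq; unfold Rsqr; lra.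
Qed.

Lemma dot_cross_sqr (V P Q : point) :
  dot V P Q ^ 2 + cross V P Q ^ 2 = (len V P * len V Q) ^ 2.
Proof.
replace ((len V P * len V Q) ^ 2) with
  ((len V P * len V P) * (len V Q * len V Q)) by ring.
rewrite !len_sqr; unfold dot, cross; ring.
Qed.

Lemma dot_cos_cross_sin (V P Q : point) :
  0 < len V P -> 0 < len V Q ->
  dot V P Q = len V P * len V Q * cos (angle P V Q) /\
  cross V P Q = len V P * len V Q * sin (angle P V Q).
Proof.
intros HP HQ.
assert (HL : 0 < len V P * len V Q) by (apply Rmult_lt_0_compat; lra).
pose proof (dot_cross_sqr V P Q) as E.
unfold angle; set (L := len V P * len V Q) in *.
assert (Hq : dot V P Q = L * (dot V P Q / L)) by (field; lra).
set (q := dot V P Q / L) in *; clearbody q L.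
assert (Hc : cross V P Q ^ 2 = L ^ 2 * (1 - q ^ 2)) by (rewrite Hq in E; nra).
assert (Hq1 : -1 <= q <= 1).
{ assert (0 <= 1 - q ^ 2).
  { apply Rmult_le_reg_l with (L ^ 2); [nra|]; rewrite <- Hc; nra. }
  split; nra. }
assert (Hsin : L * sin (acos q) = Rabs (cross V P Q)).
{ rewrite sin_acos by exact Hq1.
  rewrite <- sqrt_Rsqr_abs.
  replace (Rsqr (cross V P Q)) with (Rsqr L * (1 - Rsqr q))
    by (unfold Rsqr; lra).
  rewrite sqrt_mult_alt, sqrt_Rsqr by (try apply Rle_0_sqr; lra).
  reflexivity. }
destruct (Rlt_dec (cross V P Q) 0) as [Hn|Hn].
- rewrite cos_neg, sin_neg, cos_acos by exact Hq1.
  rewrite Rabs_left in Hsin by exact Hn; lra.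
- rewrite cos_acos by exact Hq1.
  rewrite Rabs_right in Hsin by lra; lra.
Qed.

Lemma cross_len_pos (V P Q : point) :
  cross V P Q <> 0 -> 0 < len V P /\ 0 < len V Q.
Proof.
intros H; pose proof (dot_cross_sqr V P Q) as E.
assert (0 < cross V P Q ^ 2) by nra.
pose proof (len_nonneg V P); pose proof (len_nonneg V Q).
split; apply Rnot_le_lt; intros Hle.
- replace (len V P) with 0 in E by lra; nra.
- replace (len V Q) with 0 in E by lra; nra.
Qed.

Lemma angle_pos (V P Q : point) :
  0 < cross V P Q -> 0 < angle P V Q < PI.
Proof.
intros H.
destruct (cross_len_pos V P Q ltac:(lra)) as [HP HQ].
destruct (dot_cos_cross_sin V P Q HP HQ) as [_ E].
unfold angle in *; destruct (Rlt_dec (cross V P Q) 0) as [Hn|_]; [lra|].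
pose proof (acos_bound (dot V P Q / (len V P * len V Q))) as Hb.
set (u := acos _) in *.
assert (u <> 0) by (intros Hu; rewrite Hu, sin_0 in E; lra).
assert (u <> PI) by (intros Hu; rewrite Hu, sin_PI in E; lra).
lra.
Qed.

Lemma angle_neg (V P Q : point) :
  cross V P Q < 0 -> - PI < angle P V Q < 0.
Proof.
intros H.
destruct (cross_len_pos V P Q ltac:(lra)) as [HP HQ].
destruct (dot_cos_cross_sin V P Q HP HQ) as [_ E].
unfold angle in *; destruct (Rlt_dec (cross V P Q) 0) as [_|Hn]; [|lra].
pose proof (acos_bound (dot V P Q / (len V P * len V Q))) as Hb.
set (u := acos _) in *.
assert (u <> 0) by (intros Hu; rewrite Hu, Ropp_0, sin_0 in E; lra).
assert (u <> PI) by (intros Hu; rewrite Hu, sin_neg, sin_PI in E; lra).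
lra.
Qed.

Lemma nondegenerate_cross (A B C : point) :
  nondegenerate_triangle A B C -> cross A B C <> 0.
Proof.
intros H E; apply H; clear H; unfold collinear.
unfold cross in E.
destruct (Req_dec (fst B) (fst A)) as [H1|H1];
  [destruct (Req_dec (snd B) (snd A)) as [H2|H2]|].
- (* [A] and [B] coincide: take a line through [A] and [C] if these differ. *)
  destruct (Req_dec (fst C) (fst A)) as [H3|H3].
  + exists 1, 0, (fst A); rewrite H1, H3; repeat split; lra.
  + exists (snd C - snd A), (fst A - fst C),
      ((snd C - snd A) * fst A + (fst A - fst C) * snd A).
    rewrite H1, H2; repeat split; [right; lra | ring].
- exists (snd B - snd A), (fst A - fst B),
    ((snd B - snd A) * fst A + (fst A - fst B) * snd A).
  repeat split; [left; lra | ring | lra].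
- exists (snd B - snd A), (fst A - fst B),
    ((snd B - snd A) * fst A + (fst A - fst B) * snd A).
  repeat split; [right; lra | ring | lra].
Qed.

Lemma cross_swap (A B C : point) : cross B A C = - cross A B C.
Proof. unfold cross; ring. Qed.

(** * Cevians *)

(** The law of sines in the triangle [A B X]; the oriented angles at [A] and
    [B] have opposite signs, so that their difference takes the place of the
    sum of the unsigned ones. *)
Lemma cevian_sine_law (A B C X : point) :
  cross A B C <> 0 -> on_segment B C X ->
  0 < len A X /\
  len A X * sin (angle A B C - angle B A X) = len A B * sin (angle A B C).
Proof.
intros Hc [t [_ [Hx Hy]]].
assert (HX : 0 < len A X).
{ destruct (len_nonneg A X) as [H|H]; [exact H|exfalso].
  destruct (len_eq_0 A X (eq_sym H)) as [E1 E2].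
  apply Hc; unfold cross; rewrite E1, E2, Hx, Hy; ring. }
split; [exact HX|].
destruct (cross_len_pos A B C Hc) as [Hc0 _].
assert (Hc' : cross B A C <> 0) by (rewrite cross_swap; lra).
destruct (cross_len_pos B A C Hc') as [_ Ha].
pose proof (len_sqr A B) as Hsq.
destruct (dot_cos_cross_sin A B X Hc0 HX) as [D1 S1].
rewrite len_sym in Hc0.
destruct (dot_cos_cross_sin B A C Hc0 Ha) as [D2 S2].
rewrite (len_sym B A) in *.
(* Collinearity of [B], [X], [C], in terms of the components along and across
   [AB]. *)
assert (E : dot A B X * cross B A C - cross A B X * dot B A C
            = len A B * len A B * cross B A C)
  by (rewrite Hsq; unfold dot, cross; rewrite Hx, Hy; ring).
rewrite D1, S1, D2, S2 in E.
rewrite sin_minus.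
apply Rmult_eq_reg_l with (len A B * len A B * len B C).
- lra.
- repeat apply Rmult_integral_contrapositive_currified; lra.
Qed.

Theorem mainTheorem5 :
  forall (A B C A1 B1 : point) (k : R),
    nondegenerate_triangle A B C ->
    0 < k <= 1 ->
    on_segment B C A1 ->
    angle B A A1 = k * angle B A C ->
    on_segment A C B1 ->
    angle A B B1 = k * angle A B C ->
    len A A1 = len B B1 ->
    len A C = len B C.
Proof.
intros A B C A1 B1 k Hnd Hk HA1 HangA HB1 HangB Heq.
pose proof (nondegenerate_cross A B C Hnd) as Hc.
pose proof (cross_swap A B C) as Hsw.
assert (Hc' : cross B A C <> 0) by lra.
destruct (cross_len_pos A B C Hc) as [HAB HAC].
destruct (cross_len_pos B A C Hc') as [HBA HBC].
destruct (cevian_sine_law A B C A1 Hc HA1) as [HAA1 EA].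
destruct (cevian_sine_law B A C B1 Hc' HB1) as [HBB1 EB].
(* The side [AC] is itself a cevian, which bounds the sum of the angles. *)
destruct (cevian_sine_law A B C C Hc) as [_ EC].
{ exists 1; repeat split; lra. }
destruct (dot_cos_cross_sin A B C HAB HAC) as [_ SA].
destruct (dot_cos_cross_sin B A C HBA HBC) as [_ SB].
rewrite HangA in EA; rewrite HangB in EB.
rewrite (len_sym B A) in *.
rewrite <- Heq in EB.
assert (Hlaw : len A C * sin (angle B A C) = - (len B C * sin (angle A B C))).
{ apply Rmult_eq_reg_l with (len A B); lra. }
assert (Hsides : forall u, sin u <> 0 -> len A C * sin u = len B C * sin u ->
                           len A C = len B C)
  by (intros u Hu E; exact (Rmult_eq_reg_r _ _ _ E Hu)).
assert (Hkey : sin (angle A B C) * sin (angle B A C - k * angle A B C)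
               = sin (angle B A C) * sin (angle A B C - k * angle B A C)).
{ apply Rmult_eq_reg_l with (len A A1 * len A B); [|nra].
  transitivity ((len A B * sin (angle A B C))
                * (len A A1 * sin (angle B A C - k * angle A B C))); [ring|].
  rewrite EB, <- EA; ring. }
assert (Hpi : forall u v, 0 < u < PI -> 0 < v < PI ->
                len A C * sin (u + v) = len A B * sin v -> u + v < PI).
{ intros u v Hu Hv E.
  apply Rnot_le_lt; intros Hge.
  assert (sin (u + v) <= 0) by (apply sin_le_0; lra).
  assert (0 < sin v) by (apply sin_gt_0; lra).
  nra. }
destruct (Rdichotomy _ _ Hc) as [Hneg|Hpos].
- pose proof (angle_neg A B C Hneg) as Hx.
  pose proof (angle_pos B A C ltac:(lra)) as Hy.
  set (x := angle B A C) in *; set (y := angle A B C) in *.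
  assert (Hsum : - x + y < PI).
  { apply Hpi; try lra. replace (- x + y) with (y - x) by ring; exact EC. }
  assert (Exy : - x = y).
  { apply (equal_trisa_angles k); try lra.
    replace (k * y + - x) with (- (x - k * y)) by ring.
    replace (k * - x + y) with (y - k * x) by ring.
    rewrite !sin_neg; lra. }
  apply (Hsides y).
  + assert (0 < sin y) by (apply sin_gt_0; lra); lra.
  + replace x with (- y) in Hlaw by lra; rewrite sin_neg in Hlaw; lra.
- pose proof (angle_pos A B C Hpos) as Hx.
  pose proof (angle_neg B A C ltac:(lra)) as Hy.
  set (x := angle B A C) in *; set (y := angle A B C) in *.
  assert (Hsum : x + - y < PI).
  { apply Hpi; try lra. replace (x + - y) with (- (y - x)) by ring.
    rewrite !sin_neg; lra. }
  assert (Exy : x = - y).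
  { apply (equal_trisa_angles k); try lra.
    replace (k * - y + x) with (x - k * y) by ring.
    replace (k * x + - y) with (- (y - k * x)) by ring.
    rewrite !sin_neg; lra. }
  apply (Hsides x).
  + assert (0 < sin x) by (apply sin_gt_0; lra); lra.
  + replace y with (- x) in Hlaw by lra; rewrite sin_neg in Hlaw; lra.
Qed.
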